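(* Let $\mathcal{I}_1=\{\mathbb{R}^m;f_1,f_2,\ldots,f_N\}$ and $\mathcal{I}_2=\{\mathbb{R}^m;g_1,g_2,\ldots,g_N\}$ be two iterated function systems consisting of similarity mappings, all with the same similarity ratio $c\in(0,1)$. Let $(p_1,\ldots,p_N)$ and $(q_1,\ldots,q_N)$ be probability vectors, and let $\vartheta_1$ and $\vartheta_2$ be the invariant measures associated with $\mathcal{I}_1$ with probability vector $(p_i)$ and with $\mathcal{I}_2$ with probability vector $(q_i)$, respectively. If $\mathcal{I}_1$ and $\mathcal{I}_2$ satisfy the strong separation condition, then the lower dimension of $\vartheta:=\vartheta_1\times\vartheta_2$ is $s+t$, where $s=\dim_L(\vartheta_1)$ and $t=\dim_L(\vartheta_2)$.
   Context: A similarity with ratio $c$ is a map $f:\mathbb{R}^m\to\mathbb{R}^m$ with $\|f(x)-f(y)\|_2=c\|x-y\|_2$ for all $x,y$. The attractor of an IFS $\{f_1,\dots,f_N\}$ is the unique nonempty compact set $K$ with $K=\bigcup_{i=1}^N f_i(K)$; the IFS satisfies the strong separation condition (SSC) if the sets $f_i(K)$, $1\le i\le N$, are pairwise disjoint. The invariant measure associated with an IFS $\{f_i\}$ and a probability vector $(p_i)$ (nonnegative entries with sum $1$) is the unique Borel probability measure $\mu$ with $\mu=\sum_{i=1}^N p_i\,\mu\circ f_i^{-1}$. The product measure $\vartheta_1\times\vartheta_2$ is a measure on $\mathbb{R}^{2m}$ (the invariant measure of the product IFS $\{(x,y)\mapsto(f_i(x),g_j(y))\}_{1\le i,j\le N}$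 with probability vector $(p_iq_j)_{i,j}$). For a Borel probability measure $\mu$ on a Euclidean space with support of diameter $|\mathrm{supp}(\mu)|>0$, the lower dimension is $$\dim_L(\mu)=\sup\Big\{\beta\ge0:\exists M>0\text{ such that }\forall\,0<r<R\le|\mathrm{supp}(\mu)|\text{ and }x\in\mathrm{supp}(\mu),\ \frac{\mu(\mathcal{B}_R(x))}{\mu(\mathcal{B}_r(x))}\ge M\Big(\frac{R}{r}\Big)^\beta\Big\},$$ where $\mathcal{B}_R(x)$ is the closed Euclidean ball of radius $R$ about $x$; if $|\mathrm{supp}(\mu)|=0$, then $\dim_L(\mu)=0$. *)

(* Defs.v *)
From HB Require Import structures.
From mathcomp Require Import all_boot all_order all_algebra.
From mathcomp Require Import all_classical all_reals all_analysis.
Set Implicit Arguments.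
Unset Strict Implicit.
Unset Printing Implicit Defensive.
Import Order.TTheory GRing.Theory Num.Theory.
Import numFieldNormedType.Exports.
Local Open Scope classical_set_scope.
Local Open Scope ring_scope.

(* Borel sigma-algebra of R^n. *)
HB.instance Definition _ (R : realType) (n : nat) :=
  @isMeasurable.Build (sigma_display (@open 'rV[R]_n)) 'rV[R]_n
    <<s @open 'rV[R]_n >> (@sigma_algebra0 _ setT open)
    (@sigma_algebraC _ open) (@sigma_algebra_bigcup _ setT open).

(* The library norm on ['rV[R]_n] is the sup norm; it has the same open sets
   as the Euclidean norm, but not the same balls, diameters and similarities. *)
Definition enorm (R : realType) (n : nat) (x : 'rV[R]_n) : R :=
  Num.sqrt (\sum_(i < n) x ord0 i ^+ 2).

Definition eball (R : realType) (n : nat) (x : 'rV[R]_n) (r : R) :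
    set 'rV[R]_n :=
  [set y | enorm (x - y) <= r].

Definition ediam (R : realType) (n : nat) (A : set 'rV[R]_n) : \bar R :=
  ereal_sup [set z | exists x y, [/\ A x, A y & z = (enorm (x - y))%:E]].

Definition msupport (R : realType) (n : nat) (mu : probability 'rV[R]_n R) :
    set 'rV[R]_n :=
  [set x | forall U : set 'rV[R]_n, open U -> U x -> (0 < mu U)%E].

(* The set of exponents contains [0] and may a priori be unbounded, hence the
   supremum in the extended reals. *)
Definition lower_dim (R : realType) (n : nat) (mu : probability 'rV[R]_n R) :
    \bar R :=
  if ediam (msupport mu) == 0%E then 0%E else
  ereal_sup [set beta%:E | beta in [set beta : R | 0 <= beta /\
    exists2 M : R, 0 < M &
      forall (r rho : R) (x : 'rV[R]_n),
        0 < r -> r < rho -> (rho%:E <= ediam (msupport mu))%E ->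
        msupport mu x ->
        M * (rho / r) `^ beta <=
          fine (mu (eball x rho)) / fine (mu (eball x r))]].

Definition similarity (R : realType) (n : nat) (c : R)
    (f : 'rV[R]_n -> 'rV[R]_n) : Prop :=
  forall x y, enorm (f x - f y) = c * enorm (x - y).

Definition is_attractor (R : realType) (n N : nat)
    (f : 'I_N -> 'rV[R]_n -> 'rV[R]_n) (K : set 'rV[R]_n) : Prop :=
  [/\ K !=set0, compact K & K = \bigcup_(i in [set: 'I_N]) (f i @` K)].

Definition SSC (R : realType) (n N : nat)
    (f : 'I_N -> 'rV[R]_n -> 'rV[R]_n) : Prop :=
  exists2 K : set 'rV[R]_n, is_attractor f K &
    forall i j : 'I_N, i != j -> (f i @` K) `&` (f j @` K) = set0.

Definition probability_vector (R : realType) (N : nat) (p : 'I_N -> R) : Prop :=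
  (forall i, 0 <= p i) /\ \sum_(i < N) p i = 1.

Definition is_invariant_measure (R : realType) (n N : nat)
    (f : 'I_N -> 'rV[R]_n -> 'rV[R]_n) (p : 'I_N -> R)
    (mu : probability 'rV[R]_n R) : Prop :=
  forall A : set 'rV[R]_n, measurable A ->
    mu A = (\sum_(i < N) (p i)%:E * mu (f i @^-1` A))%E.

(* The identification of R^n1 x R^n2 with R^(n1 + n2). *)
Definition row_pair (R : realType) (n1 n2 : nat)
    (z : 'rV[R]_n1 * 'rV[R]_n2) : 'rV[R]_(n1 + n2) :=
  row_mx z.1 z.2.

Lemma rat_row_dense (R : realType) (n : nat) (x : 'rV[R]_n) (e : R) :
  0 < e -> exists q : 'rV[rat]_n, ball x e (map_mx ratr q).
Proof.
move=> e0.
have H i : exists q : rat, `|x ord0 i - ratr q| < e.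
  have xe : x ord0 i - e < x ord0 i + e by rewrite ltrD2l gtrN.
  have [q] := rat_in_itvoo xe; rewrite in_itv/= => /andP[q1 q2].
  by exists q; rewrite ltr_distlC q1 q2.
have [q qP] := choice H.
exists (\row_i q i); split => // i j /=.
by rewrite !mxE ord1; exact: qP.
Qed.

Lemma measurable_row_pair (R : realType) (n1 n2 : nat) :
  measurable_fun [set: 'rV[R]_n1 * 'rV[R]_n2] (@row_pair R n1 n2).
Proof.
apply: (@measurability _ _ _ _ _ _ (@open 'rV[R]_(n1 + n2))) => //.
move=> _ [U oU <-]; rewrite setTI.
pose e (k : nat) : R := k.+1%:R^-1.
pose B (k : 'rV[rat]_(n1 + n2) * nat) : set ('rV[R]_n1 * 'rV[R]_n2) :=
  ball (lsubmx (map_mx ratr k.1) : 'rV[R]_n1) (e k.2) `*`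
  ball (rsubmx (map_mx ratr k.1) : 'rV[R]_n2) (e k.2).
have BE k z : B k z <-> ball (map_mx ratr k.1 : 'rV[R]__) (e k.2) (row_pair z).
  split=> [[[e0 B1] [_ B2]]|[e0 Bz]].
    split=> // i j; rewrite [row_pair z i j]mxE; case: fintype.splitP => l jl.
      have := B1 i l; rewrite [lsubmx _ _ _]mxE (_ : lshift _ _ = j)//.
      exact: val_inj.
    have := B2 i l; rewrite [rsubmx _ _ _]mxE (_ : rshift _ _ = j)//.
    exact: val_inj.
  split; split=> // i j.
    by have := Bz i (lshift _ j); rewrite row_mxEl [lsubmx _ _ _]mxE.
  by have := Bz i (rshift _ j); rewrite row_mxEr [rsubmx _ _ _]mxE.
pose I := [set k | B k `<=` @row_pair R n1 n2 @^-1` U].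
have -> : @row_pair R n1 n2 @^-1` U =
    \bigcup_(k : 'rV[rat]_(n1 + n2) * nat) (if k \in I then B k else set0).
  apply/seteqP; split=> [z Uz|z [k _]]; last first.
    by case: ifPn => // /set_mem; exact.
  have [d /= d0 dU] : exists2 d : R, 0 < d & ball (row_pair z) d `<=` U.
    by apply/nbhs_ballP; exact: open_nbhs_nbhs.
  have [k kd] : exists k, e k < d / 2.
    have d2 : 0 < d / 2 by rewrite divr_gt0.
    have [k _ /(_ k (leqnn k))] := near_infty_natSinv_lt (PosNum d2).
    by exists k.
  have e0 : 0 < e k by rewrite invr_gt0.
  have [q qz] := rat_row_dense (row_pair z) e0.
  exists (q, k) => //; rewrite mem_set; first by apply/BE/ball_sym.
  move=> w /BE qw; apply: dU.
  apply: (@le_ball _ _ _ (e k + e k)); first by rewrite [leRHS]splitr lerD// ltW.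
  exact: ball_triangle qz qw.
apply: countable_bigcupT_measurable; first exact: countableP.
move=> k; case: ifPn => // _; apply: measurableX;
  by apply: sub_sigma_algebra; apply: ball_open; rewrite invr_gt0.
Qed.

HB.instance Definition _ (R : realType) (n1 n2 : nat) :=
  @isMeasurableFun.Build _ _ _ _ (@row_pair R n1 n2)
    (@measurable_row_pair R n1 n2).

(* The product measure as a Borel probability measure on R^(n1 + n2). *)
Definition row_product (R : realType) (n1 n2 : nat)
    (mu : probability 'rV[R]_n1 R) (nu : probability 'rV[R]_n2 R) :
    probability 'rV[R]_(n1 + n2) R :=
  distribution (mu \x nu)%E (@row_pair R n1 n2).

(* Main.v *)
Require Import Defs.
From HB Require Import structures.
From mathcomp Require Import all_boot all_order all_algebra.
From mathcomp Require Import all_classical all_reals all_analysis.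
From mathcomp Require Import ring.
Import Order.TTheory GRing.Theory Num.Theory.
Import numFieldNormedType.Exports.
Local Open Scope classical_set_scope.
Local Open Scope ring_scope.
Set Implicit Arguments.
Unset Strict Implicit.
Unset Printing Implicit Defensive.

(** Under the SSC, the mass of a ball of radius about [c ^+ k] centred in the
    support is, up to a bounded change of scale, the weight of the cylinder of
    level [k] containing the centre, i.e. a product of [k] of the
    probabilities. The mass ratio between scales [c ^+ k] and [c ^+ l] is
    therefore at least [(max p) ^- (l - k)], with equality at the fixed point
    of a map of maximal weight, so the lower dimension is
    [ln (max p) / ln c]. A ball of the product measure is squeezed between
    products of balls, so the product measure obeys the same law with
    [max p * max q], and the logarithm turns the product into a sum. *)

(** * Euclidean norm, its balls, and distances on compact sets *)

Section EuclideanNorm.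
Context {R : realType} {n : nat}.
Implicit Types (x y : 'rV[R]_n) (r : R) (A : set 'rV[R]_n).

Lemma enorm_ge0 x : 0 <= enorm x.
Proof. exact: sqrtr_ge0. Qed.

Lemma sqr_enorm x : enorm x ^+ 2 = \sum_(i < n) x ord0 i ^+ 2.
Proof. by rewrite sqr_sqrtr// sumr_ge0// => i _; rewrite sqr_ge0. Qed.

Lemma enorm0 : enorm (0 : 'rV[R]_n) = 0.
Proof.
by apply/eqP; rewrite -sqrf_eq0 sqr_enorm big1// => i _; rewrite mxE expr0n.
Qed.

Lemma enormN x : enorm (- x) = enorm x.
Proof. by congr Num.sqrt; apply: eq_bigr => i _; rewrite mxE sqrrN. Qed.

Lemma enorm_distC x y : enorm (x - y) = enorm (y - x).
Proof. by rewrite -enormN opprB. Qed.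

Lemma ler_coord_enorm x i : `|x ord0 i| <= enorm x.
Proof.
rewrite -sqrtr_sqr ler_sqrt; last by apply: sumr_ge0 => j _; rewrite sqr_ge0.
by rewrite (bigD1 i)//= lerDl sumr_ge0// => j _; rewrite sqr_ge0.
Qed.

Lemma enorm_eq0 x : enorm x = 0 -> x = 0.
Proof.
move=> x0; apply/rowP => i; apply/eqP; rewrite mxE -normr_le0 -x0.
exact: ler_coord_enorm.
Qed.

Lemma enorm_continuous : continuous (@enorm R n).
Proof.
have S : continuous (fun x : 'rV[R]_n => \sum_(i < n) x ord0 i ^+ 2).
  apply: continuous_big => [|i _ x]; first exact: add_continuous.
  apply: (@continuous_comp _ R R (fun y : 'rV[R]_n => y ord0 i) (fun t => t ^+ 2)).
    exact: coord_continuous.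
  exact: exprn_continuous.
by move=> x; apply: continuous_comp; [exact: S|exact: sqrt_continuous].
Qed.

Lemma enormB_continuous (T : topologicalType) (f g : T -> 'rV[R]_n) :
  continuous f -> continuous g -> continuous (fun t => enorm (f t - g t)).
Proof.
move=> cf cg t.
apply: (@continuous_comp _ _ _ (fun t => f t - g t) (@enorm R n)).
  by apply: cvgB; [exact: cf|exact: cg].
exact: enorm_continuous.
Qed.

Lemma enormBr_continuous x : continuous (fun y => enorm (x - y)).
Proof.
apply: enormB_continuous.
  exact: cst_continuous.
by move=> y; exact: cvg_id.
Qed.

(** Each coordinate is bounded by [enorm], so a Euclidean ball lies inside the sup-norm ball of the
    same radius, which generates the topology. *)
Lemma nbhs_enorm x A : nbhs x A ->
  exists2 r : R, 0 < r & [set y | enorm (x - y) < r] `<=` A.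
Proof.
move=> /nbhs_ballP[r /= r0 rA]; exists r => // y /= xy; apply: rA; split=> // i j.
rewrite ord1 /ball /=.
by apply: le_lt_trans xy; rewrite (le_trans _ (ler_coord_enorm _ j))// !mxE.
Qed.

Lemma open_enorm_ball x r : open [set y | enorm (x - y) < r].
Proof.
apply: (@open_comp _ _ (fun y => enorm (x - y)) [set t | t < r]);
  last exact: open_lt.
by move=> y _; exact: enormBr_continuous.
Qed.

Lemma enorm_lt_nbhs x r : 0 < r -> nbhs x [set y | enorm (x - y) < r].
Proof.
move=> r0; apply: open_nbhs_nbhs; split; first exact: open_enorm_ball.
by rewrite /= subrr enorm0.
Qed.

Lemma closed_eball x r : closed (eball x r).
Proof.
apply: (@preimage_closed _ _ (fun y => enorm (x - y)) [set t | t <= r]);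
  last exact: closed_le.
by move=> y _; exact: enormBr_continuous.
Qed.

Lemma open_measurable_rV A : open A -> measurable A.
Proof. exact: sub_sigma_algebra. Qed.

Lemma closed_measurable_rV A : closed A -> measurable A.
Proof.
move=> cA; rewrite -(setCK A); apply: measurableC.
by apply: open_measurable_rV; exact: closed_openC.
Qed.

Lemma measurable_eball x r : measurable (eball x r).
Proof. by apply: closed_measurable_rV; exact: closed_eball. Qed.

Lemma compact_enorm_bounded A : compact A ->
  exists2 D : R, 0 < D & forall x y, A x -> A y -> enorm (x - y) <= D.
Proof.
move=> cA; have [->|A0] := eqVneq A set0; first by exists 1.
have /set0P A2 : A `*` A != set0.
  by move/set0P : A0 => [x Ax]; apply/set0P; exists (x, x).
have [|z _ zmax] := @compact_EVT_max _ R
  (fun z : 'rV[R]_n * 'rV[R]_n => enorm (z.1 - z.2)) _ A2 (compact_setX cA cA).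
  apply: continuous_subspaceT; apply: enormB_continuous => ?;
    [exact: cvg_fst|exact: cvg_snd].
(* The added 1 keeps the bound positive when [A] is a single point. *)
exists (enorm (z.1 - z.2) + 1) => [|x y Ax Ay].
  by rewrite ltr_wpDl ?enorm_ge0.
rewrite (le_trans (zmax (x, y) _)) ?lerDl//.
by rewrite inE.
Qed.

(** The distance attains its minimum on the compact product [A] times [B]; a zero minimum would give
    a common point. *)
Lemma compact_disjoint_gap A B : compact A -> compact B -> A `&` B = set0 ->
  exists2 d : R, 0 < d & forall x y, A x -> B y -> d <= enorm (x - y).
Proof.
move=> cA cB AB0; have [AB|/set0P AB] := eqVneq (A `*` B) set0.
  by exists 1 => // x y Ax By; have : (A `*` B) (x, y) by []; rewrite AB.
have [|[u v]] := @compact_EVT_min _ R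
  (fun z : 'rV[R]_n * 'rV[R]_n => enorm (z.1 - z.2)) _ AB (compact_setX cA cB).
  apply: continuous_subspaceT; apply: enormB_continuous => ?;
    [exact: cvg_fst|exact: cvg_snd].
rewrite inE => -[/= Au Bv] zmin; exists (enorm (u - v)) => [|x y Ax By]; last first.
  by apply: (zmin (x, y)); rewrite inE.
rewrite lt_neqAle enorm_ge0 andbT eq_sym; apply/eqP => /enorm_eq0/subr0_eq uv.
have : (A `&` B) u by split=> //; rewrite uv.
by rewrite AB0.
Qed.

End EuclideanNorm.

(** * Geometric scales and real powers *)

Lemma expr_lt_eps {R : realType} (z e : R) : 0 <= z < 1 -> 0 < e ->
  exists k, forall j, (k <= j)%N -> z ^+ j < e.
Proof.
move=> /andP[z0 z1] e0; have z1' : `|z| < 1 by rewrite ger0_norm.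
have /cvgr_lt/(_ e e0)[k _ kP] := cvg_expr z1'.
by exists k => j kj; exact: (kP j kj).
Qed.

(** Rounds a radius to the grid of the [e * c ^+ k]: the least admissible [k] is taken, and
    minimality gives the strict bound at every coarser level. *)
Lemma geometric_scale {R : realType} (c e r : R) : 0 < c < 1 -> 0 < e -> 0 < r ->
  exists2 k, e * c ^+ k <= r & forall j, (j < k)%N -> r < e * c ^+ j.
Proof.
move=> /andP[c0 c1] e0 r0.
have c01 : 0 <= c < 1 by rewrite ltW.
have [k kP] := expr_lt_eps c01 (divr_gt0 r0 e0).
have ex : exists k, e * c ^+ k <= r.
  by exists k; rewrite mulrC -ler_pdivlMr// ltW// kP.
case: (ex_minnP ex) => n nr nmin; exists n => // j jn.
by rewrite ltNge; apply/negP => /nmin; rewrite leqNgt jn.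
Qed.

Lemma powR_ln_div {R : realType} (c W : R) : 0 < c < 1 -> 0 < W ->
  c `^ (ln W / ln c) = W.
Proof.
move=> /andP[c0 c1] W0; rewrite /powR gt_eqF// divfK ?lnK//.
by rewrite lt_eqF// ln_lt0// c0 c1.
Qed.

Lemma powR_exprn {R : realType} (x b : R) k : 0 <= x ->
  (x ^+ k) `^ b = (x `^ b) ^+ k.
Proof.
move=> x0; elim: k => [|k IH]; first by rewrite !expr0 powR1.
by rewrite !exprS powRM ?exprn_ge0// IH.
Qed.

(** * Masses of balls, support and diameter *)

Section Mass.
Context {R : realType} {n : nat} (mu : probability 'rV[R]_n R).
Implicit Types (A B : set 'rV[R]_n) (x : 'rV[R]_n).

Lemma fine_probabilityK A : measurable A -> (fine (mu A))%:E = mu A.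
Proof. by move=> mA; rewrite fineK// fin_num_measure. Qed.

Lemma le_fine_probability A B : measurable A -> measurable B -> A `<=` B ->
  fine (mu A) <= fine (mu B).
Proof.
by move=> mA mB AB; rewrite -lee_fin !fine_probabilityK// le_measure ?inE.
Qed.

Lemma fine_probability_le1 A : measurable A -> fine (mu A) <= 1.
Proof. by move=> mA; rewrite -lee_fin fine_probabilityK// probability_le1. Qed.

(** A closed ball of half the radius fits inside an open one, so closed balls can replace open sets.
    Membership in the support thus becomes a statement about the masses that are estimated below. *)
Lemma msupportP x :
  msupport mu x <-> forall r : R, 0 < r -> 0 < fine (mu (eball x r)).
Proof.
split=> [xs r r0|xs U oU Ux].
  rewrite -lte_fin fine_probabilityK; last exact: measurable_eball.
  apply: (@lt_le_trans _ _ (mu [set y | enorm (x - y) < r])).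
    apply: xs; first exact: open_enorm_ball.
    by rewrite /= subrr enorm0.
  rewrite le_measure ?inE//; last by move=> y /= /ltW.
    by apply: open_measurable_rV; exact: open_enorm_ball.
  exact: measurable_eball.
have [r r0 rU] : exists2 r : R, 0 < r & [set y | enorm (x - y) < r] `<=` U.
  by apply: nbhs_enorm; exact: open_nbhs_nbhs.
have r20 : 0 < r / 2 by rewrite divr_gt0.
have := xs _ r20; rewrite -lte_fin fine_probabilityK; last exact: measurable_eball.
move=> /lt_le_trans; apply; rewrite le_measure ?inE//.
- exact: measurable_eball.
- exact: open_measurable_rV.
- move=> y xy; apply: rU; apply: (le_lt_trans xy).
  by rewrite ltr_pdivrMr// ltr_pMr// ltr1n.
Qed.

End Mass.

Lemma ediam_le {R : realType} {n : nat} (A : set 'rV[R]_n) x y : A x -> A y ->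
  ((enorm (x - y))%:E <= ediam A)%E.
Proof. by move=> Ax Ay; apply: ereal_sup_ubound; exists x, y. Qed.

Lemma ediam_eq0 {R : realType} {n : nat} (A : set 'rV[R]_n) : A !=set0 ->
  ediam A = 0%E <-> forall x y, A x -> A y -> x = y.
Proof.
move=> [a Aa]; split=> [A0 x y Ax Ay|Axy].
  apply: subr0_eq; apply: enorm_eq0; apply/eqP; rewrite eq_le enorm_ge0 andbT.
  by rewrite -lee_fin (le_trans (ediam_le Ax Ay))// A0.
rewrite /ediam (_ : [set z | _] = [set 0%E]) ?ereal_sup1//.
apply/seteqP; split=> [_ [x [y [Ax Ay ->]]]|_ ->] /=.
  by rewrite (Axy x y)// subrr enorm0.
by exists a, a; rewrite subrr enorm0.
Qed.

(* [W] is the largest weight, [P k] the weight of the cylinder of level [k]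
   around [x]; a ball of radius [< d * c ^+ k] meets no other cylinder of that
   level, and one of radius [>= D * c ^+ k] covers it. *)
Record cascade {R : realType} {n : nat} (c W d D : R)
    (mu : probability 'rV[R]_n R) : Prop := Cascade {
  cascade_bounded : forall x y, msupport mu x -> msupport mu y ->
    enorm (x - y) <= D;
  cascade_masses : forall x, msupport mu x -> exists P : nat -> R,
    [/\ P 0%N = 1, forall k, 0 <= P k.+1 <= W * P k,
      forall k r, r < d * c ^+ k -> fine (mu (eball x r)) <= P k &
      forall k r, D * c ^+ k <= r -> P k <= fine (mu (eball x r))];
  cascade_heaviest : exists2 x, msupport mu x &
    forall k, W ^+ k <= fine (mu (eball x (D * c ^+ k)));
  cascade_spread : W < 1 -> exists x y, [/\ msupport mu x, msupport mu y & x <> y]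
}.

(** * Lower dimension of a measure with a cascade *)

Section LowerDimension.
Context {R : realType} {n : nat} {c W d D : R} {mu : probability 'rV[R]_n R}.
Hypotheses (hc : 0 < c < 1) (hW : 0 < W <= 1) (d0 : 0 < d) (D0 : 0 < D).
Hypothesis mu_cascade : cascade c W d D mu.

(** Rounding [rho] to level [k] and [r] to level [j] compares the two masses with [P k] and [P j],
    and each level in between loses a factor of at least [W], which is [c] to the power [b]. *)
Lemma cascade_growth : exists2 M : R, 0 < M & forall (r rho : R) x,
  0 < r -> r < rho -> rho <= D -> msupport mu x ->
  M * (rho / r) `^ (ln W / ln c) <=
    fine (mu (eball x rho)) / fine (mu (eball x r)).
Proof.
have [[c0 c1] [W0 W1]] := (andP hc, andP hW).
set b := ln W / ln c.
have b0 : 0 <= b by rewrite mulr_le0// ?invr_le0 ln_le0// ltW.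
(* [D / d] compares the covering and separating scales; rounding [rho] and rounding [r] to the grid
   cost one factor [c] each. *)
pose C := D / (d * c ^+ 2).
have C0 : 0 < C by rewrite divr_gt0// mulr_gt0// exprn_gt0.
exists (C `^ b)^-1 => [|r rho x r0 rrho rhoD xs];
  first by rewrite invr_gt0 powR_gt0.
have rho0 : 0 < rho := lt_trans r0 rrho.
have [_ masses _ _] := mu_cascade; have [P [P0 PW Pub Plb]] := masses x xs.
have [k krho kmin] := geometric_scale hc D0 rho0.
have [l lr lmin] := geometric_scale hc d0 r0.
(* Level [l] is the first with [d * c ^+ l <= r], so the ball of radius [r] is still separated at
   level [l.-1]. For [l = 0] the predecessor is 0, and [P 0 = 1] bounds any mass. *)
pose j := l.-1.
(* For [k = 0] no coarser level exists, and [rho <= D] takes its place. *)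
have rhok : rho * c <= D * c ^+ k.
  case: k {krho} kmin => [|k] /= kmin.
    by rewrite expr0 mulr1 (le_trans _ rhoD)// ler_piMr// ltW.
  by rewrite exprSr mulrA ler_pM2r// ltW// kmin.
have rj : d * c ^+ j.+1 <= r.
  apply: le_trans lr; rewrite ler_pM2l//.
  by apply: ler_wiXn2l; [exact: ltW|exact: ltW|exact: leqSpred].
have muj : fine (mu (eball x r)) <= P j.
  rewrite /j; case: l {lr rj j} lmin => [|l] lmin /=;
    last by apply: Pub; apply: lmin.
  by rewrite P0 fine_probability_le1//; exact: measurable_eball.
have muk : P k <= fine (mu (eball x rho)) by exact: Plb.
have Pge0 i : 0 <= P i by case: i => [|i]; [rewrite P0|have /andP[] := PW i].
have PWn i t : P (i + t)%N <= W ^+ t * P i.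
  elim: t => [|t IH]; first by rewrite addn0 expr0 mul1r.
  rewrite addnS exprS -mulrA; have /andP[_ /le_trans->//] := PW (i + t)%N.
  by rewrite ler_pM2l.
(* If [k <= j], the cylinder of level [j] weighs at most [W ^+ (j - k)] times that of level [k]. If
   [j < k], monotonicity of the powers of [W] and of the balls suffices. *)
have key : W ^+ k * fine (mu (eball x r)) <= W ^+ j * fine (mu (eball x rho)).
  have [kj|jk] := leqP k j.
    have := PWn k (j - k)%N; rewrite subnKC// => Pj.
    have -> : W ^+ j = W ^+ k * W ^+ (j - k) by rewrite -exprD subnKC.
    rewrite -mulrA ler_pM2l ?exprn_gt0//; apply: (le_trans (le_trans muj Pj)).
    by rewrite ler_pM2l ?exprn_gt0.
  apply: ler_pM.
  - by rewrite exprn_ge0// ltW.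
  - by rewrite fine_ge0.
  - by apply: ler_wiXn2l; [exact: ltW|exact: W1|exact: ltnW].
  - apply: le_fine_probability; [exact: measurable_eball|exact: measurable_eball|].
    by move=> y /le_trans; apply; exact: ltW.
have ratio : rho / r * c ^+ j <= C * c ^+ k.
  rewrite mulrAC ler_pdivrMr// /C.
  have [dn cn] : d != 0 /\ c != 0 by rewrite !gt_eqF.
  have -> : D / (d * c ^+ 2) * c ^+ k * r = D * c ^+ k * (r / (d * c ^+ 2)).
    by field; rewrite dn cn.
  have -> : rho * c ^+ j = rho * c * (c ^+ j / c) by field.
  apply: ler_pM => //; first by rewrite mulr_ge0 ?ltW.
    by rewrite divr_ge0 ?exprn_ge0 ?ltW.
  rewrite ler_pdivlMr; last by rewrite mulr_gt0 ?exprn_gt0.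
  have -> // : c ^+ j / c * (d * c ^+ 2) = d * c ^+ j.+1.
  by rewrite [c ^+ j.+1]exprS; field.
have powRj (x' : R) i : 0 <= x' -> x' `^ b * W ^+ i = (x' * c ^+ i) `^ b.
  move=> x'0; rewrite powRM// ?exprn_ge0 ?(ltW c0)//.
  by rewrite powR_exprn ?(ltW c0)// powR_ln_div.
have scaled : (rho / r) `^ b * W ^+ j <= C `^ b * W ^+ k.
  rewrite !powRj ?(ltW C0) ?divr_ge0 ?(ltW rho0) ?(ltW r0)//.
  have ci i : 0 <= c ^+ i by rewrite exprn_ge0// ltW.
  by apply: ge0_ler_powR => //; rewrite nnegrE mulr_ge0// ?ltW// divr_gt0.
have mur : 0 < fine (mu (eball x r)) by have /msupportP := xs; exact.
have Cb : 0 < C `^ b by rewrite powR_gt0.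
rewrite ler_pdivlMr// -(ler_pM2l (exprn_gt0 j W0)); apply: le_trans key.
rewrite -(ler_pM2l Cb) (_ : _ * (_ * _) =
    (rho / r) `^ b * W ^+ j * fine (mu (eball x r))); last first.
  by field; rewrite gt_eqF.
by rewrite mulrA ler_pM2r.
Qed.

(** Tested at the heaviest point with [r = D * c ^+ k], growth with [c] to the power [beta] below
    [W] would push the mass of the ball of radius [rho0] above 1 for large [k]. A single outer
    radius is enough. *)
Lemma cascade_exponent_le (beta M rho0 : R) : 0 <= beta -> 0 < M -> 0 < rho0 ->
  (forall r x, 0 < r -> r < rho0 -> msupport mu x ->
    M * (rho0 / r) `^ beta <=
      fine (mu (eball x rho0)) / fine (mu (eball x r))) ->
  beta <= ln W / ln c.
Proof.
have [[c0 c1] [W0 W1]] := (andP hc, andP hW).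
move=> beta0 M0 rho00 growth.
have [_ _ [x xs xW] _] := mu_cascade.
pose A := M * (rho0 / D) `^ beta.
have A0 : 0 < A by rewrite mulr_gt0// powR_gt0// divr_gt0.
have lnc : ln c < 0 by rewrite ln_lt0// c0.
suff Wc : W <= c `^ beta.
  by rewrite ler_ndivlMr// -ln_powR ler_ln// posrE powR_gt0.
rewrite leNgt; apply/negP => cW.
have c01 : 0 <= c < 1 by rewrite ltW.
have z01 : 0 <= c `^ beta / W < 1.
  by rewrite divr_ge0 ?powR_ge0 ?(ltW W0)//= ltr_pdivrMr// mul1r.
have [k1 k1P] := expr_lt_eps z01 A0.
have [k2 k2P] := expr_lt_eps c01 (divr_gt0 rho00 D0).
(* [k1] makes the ratio of the geometric sequences smaller than the constant [A]; [k2] makes the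
   test radius smaller than [rho0]. *)
pose k := maxn k1 k2.
have rk : D * c ^+ k < rho0 by rewrite mulrC -ltr_pdivlMr// k2P// leq_maxr.
have rk0 : 0 < D * c ^+ k by rewrite mulr_gt0// exprn_gt0.
have mk := k1P k (leq_maxl _ _).
have Wk := xW k.
have Wk0 : 0 < W ^+ k by rewrite exprn_gt0.
have mu0 : 0 < fine (mu (eball x (D * c ^+ k))) := lt_le_trans Wk0 Wk.
have := growth _ _ rk0 rk xs; apply/negP; rewrite -ltNge ltr_pdivrMr//.
apply: (@le_lt_trans _ _ 1).
  by apply: fine_probability_le1; exact: measurable_eball.
have ck0 : 0 < (c `^ beta) ^+ k by rewrite exprn_gt0// powR_gt0.
have -> : M * (rho0 / (D * c ^+ k)) `^ beta = A / (c `^ beta) ^+ k.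
  rewrite /A invfM mulrA powRM ?invr_ge0 ?divr_ge0 ?exprn_ge0
    ?(ltW D0) ?(ltW c0) ?(ltW rho00)//.
  rewrite mulrA -powR_exprn ?(ltW c0)//; congr (_ * _).
  by rewrite -!powR_inv1 ?exprn_ge0 ?powR_ge0 ?(ltW c0)// -!powRrM mulrC.
apply: (@lt_le_trans _ _ (A / (c `^ beta) ^+ k * W ^+ k)); last first.
  by rewrite ler_pM2l// divr_gt0.
rewrite mulrAC ltr_pdivlMr// mul1r -ltr_pdivrMr//.
by move: mk; rewrite expr_div_n.
Qed.

Lemma lower_dim_cascade : lower_dim mu = (ln W / ln c)%:E.
Proof.
have [[c0 c1] [W0 W1]] := (andP hc, andP hW).
have [bounded _ [x xs _] spread] := mu_cascade.
have s0 : msupport mu !=set0 by exists x.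
have diamD : (ediam (msupport mu) <= D%:E)%E.
  apply: ge_ereal_sup => _ [y [z [ys zs ->]]].
  by rewrite lee_fin bounded.
(* A one-point support has dimension 0 by convention; the formula agrees, since [cascade_spread]
   then forces [W = 1]. *)
rewrite /lower_dim; case: ifPn => [/eqP/(ediam_eq0 s0) single|diam0].
  have -> : W = 1; last by rewrite ln1 mul0r.
  apply/eqP; rewrite eq_le W1 leNgt; apply/negP => /spread[y [z [ys zs]]].
  by apply; exact: single.
have [y [z [ys zs yz]]] : exists y z, [/\ msupport mu y, msupport mu z & y <> z].
  apply: contrapT => nspread; move/eqP: diam0; apply; apply/(ediam_eq0 s0).
  by move=> y z ys zs; apply: contrapT => yz; apply: nspread; exists y, z.
have b0 : 0 <= ln W / ln c by rewrite mulr_le0// ?invr_le0 ln_le0// ltW.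
apply/eqP; rewrite eq_le; apply/andP; split.
  apply: ge_ereal_sup => _ [beta [beta0 [M M0 growth]] <-].
  (* The distance of two support points is at most the diameter, hence an admissible outer
     radius. *)
  have rho00 : 0 < enorm (y - z).
    by rewrite lt_neqAle enorm_ge0 andbT eq_sym; apply/eqP => /enorm_eq0/subr0_eq.
  rewrite lee_fin; apply: (cascade_exponent_le beta0 M0 rho00) => r w r0 rrho ws.
  by apply: growth => //; exact: ediam_le.
apply: ereal_sup_ubound; exists (ln W / ln c) => //; split=> //.
have [M M0 growth] := cascade_growth; exists M => // r rho w r0 rrho rhod ws.
by apply: growth => //; rewrite -lee_fin (le_trans rhod).
Qed.
End LowerDimension.

(** * Similarities: continuity and preimages of balls *)

Section Similarity.
Context {R : realType} {n : nat} {c : R} {f : 'rV[R]_n -> 'rV[R]_n}.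
Hypotheses (c0 : 0 < c) (hf : similarity c f).

Lemma similarity_continuous : continuous f.
Proof.
move=> x A /nbhs_enorm[r r0 rA].
have rc0 : 0 < r / c by rewrite divr_gt0.
apply: filterS (enorm_lt_nbhs x rc0) => y /= xy; apply: rA => /=.
by rewrite hf mulrC -ltr_pdivlMr.
Qed.

Lemma preimage_eball_similarity x r :
  f @^-1` (eball (f x) r) = eball x (r / c).
Proof.
by apply/seteqP; split=> y; rewrite /eball /= hf ler_pdivlMr// mulrC.
Qed.

Lemma measurable_preimage_similarity A : measurable A -> measurable (f @^-1` A).
Proof.
suff mf : measurable_fun setT f.
  by move=> mA; rewrite -[_ @^-1` _]setTI; exact: mf.
apply: (@measurability _ _ _ _ _ _ (@open 'rV[R]_n)) => //.
move=> _ [U oU <-]; rewrite setTI; apply: open_measurable_rV.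
by apply: open_comp => // x _; exact: similarity_continuous.
Qed.

End Similarity.

(** * Invariant measures are carried by the attractor *)

Section SelfSimilar.
Context {R : realType} {n N : nat} {c : R} {f : 'I_N -> 'rV[R]_n -> 'rV[R]_n}.
Context {p : 'I_N -> R} {mu : probability 'rV[R]_n R} {K : set 'rV[R]_n}.
Hypotheses (hc : 0 < c < 1) (hf : forall i, similarity c (f i)).
Hypotheses (hp : probability_vector p) (hmu : is_invariant_measure f p mu).
Hypothesis hK : is_attractor f K.

Let c0 : 0 < c. Proof. by case/andP: hc. Qed.
Let c1 : c < 1. Proof. by case/andP: hc. Qed.
Let p0 i : 0 <= p i. Proof. by case: hp. Qed.

Lemma attractor_image i x : K x -> K (f i x).
Proof. by move=> Kx; have [_ _ ->] := hK; exists i => //; exists x. Qed.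

Lemma attractor_preimage x : K x -> exists i, exists2 y, K y & f i y = x.
Proof.
by have [_ _ KE] := hK; rewrite {1}KE => -[i _ [y Ky <-]]; exists i, y.
Qed.

Lemma fine_invariant A : measurable A ->
  fine (mu A) = \sum_(i < N) p i * fine (mu (f i @^-1` A)).
Proof.
move=> mA; apply: EFin_inj; rewrite fine_probabilityK// hmu// -sumEFin.
apply: eq_bigr => i _; rewrite EFinM fine_probabilityK//.
exact: (measurable_preimage_similarity c0 (hf i)).
Qed.

Lemma invariant_ge i A : measurable A ->
  p i * fine (mu (f i @^-1` A)) <= fine (mu A).
Proof.
move=> mA; rewrite [leRHS]fine_invariant// (bigD1 i)//= lerDl sumr_ge0// => j _.
by apply: mulr_ge0 => //; exact: fine_ge0.
Qed.

(** The open Euclidean neighbourhood of [K] of radius [r]. *)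
Let U (r : R) := \bigcup_(y in K) [set x | enorm (y - x) < r].

Let open_U r : open (U r).
Proof. by apply: bigcup_open => y _; exact: open_enorm_ball. Qed.

Let measurable_U r : measurable (U r).
Proof. by apply: open_measurable_rV; exact: open_U. Qed.

(** Each [f i] sends [U r] into [U (c * r)] because it sends [K] into itself; invariance averages
    these inclusions with weights of sum 1. *)
Let mass_U_contract r : fine (mu (U r)) <= fine (mu (U (c * r))).
Proof.
rewrite [leRHS]fine_invariant// -[leLHS]mul1r -(proj2 hp) mulr_suml.
apply: ler_sum => i _; apply: ler_wpM2l => //; apply: le_fine_probability => //.
  exact: (measurable_preimage_similarity c0 (hf i)).
move=> x [y Ky yx]; exists (f i y); first exact: attractor_image.
by rewrite /= hf ltr_pM2l.
Qed.

(* Shrinking does not lose mass: [U r] carries at least the mass of each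
   [U (r / c ^+ k)], and these exhaust the space. *)
Let mass_U r : 0 < r -> mu (U r) = 1%E.
Proof.
move=> r0; apply/eqP; rewrite eq_le probability_le1//=.
pose F k := U (r / c ^+ k).
have F_le k : (mu (F k) <= mu (U r))%E.
  rewrite -(fine_probabilityK mu (measurable_U r)).
  rewrite -(fine_probabilityK mu (measurable_U (r / c ^+ k))) lee_fin /F.
  elim: k => [|k IH]; first by rewrite expr0 divr1.
  apply: le_trans IH; apply: le_trans (mass_U_contract _) _.
  by rewrite exprS invfM mulrCA [c * (_ * _)]mulrA divff ?gt_eqF// mul1r.
have FT : \bigcup_k F k = setT.
  apply/seteqP; split=> // x _; have [[y Ky] _ _] := hK.
  have e0 : 0 < r / (enorm (y - x) + 1) by rewrite divr_gt0// ltr_wpDl ?enorm_ge0.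
  have c01 : 0 <= c < 1 by rewrite ltW.
  have [k kP] := expr_lt_eps c01 e0.
  exists k => //; exists y => //=; rewrite ltr_pdivlMr ?exprn_gt0// mulrC.
  have := kP k (leqnn k); rewrite ltr_pdivlMr ?ltr_wpDl ?enorm_ge0//.
  by apply: le_lt_trans; rewrite ler_pM2l ?exprn_gt0// lerDl.
have F_cvg : mu (F k) @[k --> \oo] --> mu (\bigcup_k F k).
  apply: nondecreasing_cvg_mu => [k||]; first exact: measurable_U.
    by rewrite FT.
  move=> i j ij; apply/subsetPset => x [y Ky /= yx]; exists y => //=.
  apply: (lt_le_trans yx); rewrite ler_pM2l// lef_pV2 ?posrE ?exprn_gt0//.
  by apply: ler_wiXn2l => //; exact: ltW.
rewrite -(probability_setT mu) -FT -(cvg_lim _ F_cvg)//.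
apply: lime_le; first exact: cvgP F_cvg.
by apply: nearW.
Qed.

Lemma attractor_closed : closed K.
Proof.
by have [_ cK _] := hK; apply: compact_closed => //; exact: norm_hausdorff.
Qed.

Lemma null_outside_attractor A : measurable A -> (forall x, A x -> ~ K x) ->
  fine (mu A) = 0.
Proof.
move=> mA AK.
suff : mu.-negligible A by move=> /(negligibleP _ mA) ->.
(* As [K] is closed, a point in every [U (c ^+ k)] lies in [K]; so [A] is covered by countably many
   null complements. *)
apply: (@negligibleS _ _ _ _ (\bigcup_k ~` U (c ^+ k))).
  move=> x Ax; apply: contrapT => xU; apply: (AK x Ax).
  apply: attractor_closed => B /nbhs_enorm[r r0 rB].
  have c01 : 0 <= c < 1 by rewrite ltW.
  have [k kP] := expr_lt_eps c01 r0.
  have [y Ky /= yx] : U (c ^+ k) x by apply: contrapT => xk; apply: xU; exists k.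
  exists y; split=> //; apply: rB; rewrite /= enorm_distC.
  by apply: lt_trans yx (kP _ _).
apply: negligible_bigcup => k; apply/negligibleP; first exact: measurableC.
by rewrite /= probability_setC// mass_U ?exprn_gt0// subee.
Qed.

Lemma attractor_full A : measurable A -> K `<=` A -> fine (mu A) = 1.
Proof.
move=> mA KA; have : fine (mu (~` A)) = 0.
  apply: null_outside_attractor; first exact: measurableC.
  by move=> x Ax /KA.
rewrite probability_setC// -(fine_probabilityK mu mA) -EFinB /= => /subr0_eq.
by [].
Qed.

Lemma msupport_sub_attractor : msupport mu `<=` K.
Proof.
move=> x xs; apply: contrapT => xK.
have oK : open (~` K) by apply: closed_openC; exact: attractor_closed.
have := xs _ oK xK; rewrite -fine_probabilityK; last exact: open_measurable_rV.
rewrite null_outside_attractor ?ltxx//; exact: open_measurable_rV.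
Qed.

Lemma mass_eball_image_ge i x r :
  p i * fine (mu (eball x (r / c))) <= fine (mu (eball (f i x) r)).
Proof.
rewrite -(preimage_eball_similarity c0 (hf i)).
by apply: invariant_ge; exact: measurable_eball.
Qed.

Lemma mass_eball_image_le (d : R) i x r :
  (forall j u v, i != j -> K u -> K v -> d <= enorm (f i u - f j v)) ->
  K x -> r < d ->
  fine (mu (eball (f i x) r)) <= p i * fine (mu (eball x (r / c))).
Proof.
move=> gap Kx rd; rewrite [leLHS]fine_invariant; last exact: measurable_eball.
rewrite (bigD1 i)//= (preimage_eball_similarity c0 (hf i)) gerDl big1// => j ji.
rewrite null_outside_attractor ?mulr0//.
  by apply: (measurable_preimage_similarity c0 (hf j)); exact: measurable_eball.
move=> y /= yr Ky; have := gap j x y; rewrite eq_sym ji => /(_ isT Kx Ky).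
by rewrite leNgt; move/negP; apply; exact: le_lt_trans rd.
Qed.

(* A minimizer of [enorm (x - f i x)] on the attractor is fixed, since passing
   from [x] to [f i x] multiplies this quantity by [c]. *)
Lemma similarity_fixpoint i : exists2 x, K x & f i x = x.
Proof.
have [K0 cK _] := hK.
have cont : continuous (fun x : 'rV[R]_n => enorm (x - f i x)).
  apply: enormB_continuous; last exact: (similarity_continuous c0 (hf i)).
  by move=> x; exact: cvg_id.
have [x /set_mem Kx xmin] := compact_EVT_min K0 cK (continuous_subspaceT cont).
exists x => //; apply/esym/subr0_eq/enorm_eq0/eqP.
rewrite eq_le enorm_ge0 andbT leNgt; apply/negP => x0.
have := xmin (f i x); rewrite inE => /(_ (attractor_image i Kx)).
by rewrite hf leNgt gtr_pMl// c1.
Qed.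

End SelfSimilar.

(** * Probability vectors and finite minima *)

Lemma probability_vector_max {R : realType} {N : nat} (p : 'I_N -> R) (i0 : 'I_N) :
  probability_vector p -> exists2 i, 0 < p i <= 1 & forall j, p j <= p i.
Proof.
move=> [p0 p1]; case: (@arg_maxP _ _ _ i0 xpredT p isT) => i _ imax.
have pj j : p j <= p i by exact: imax.
exists i => //; apply/andP; split.
  rewrite lt_neqAle p0 andbT eq_sym; apply/eqP => pi0.
  have := oner_neq0 R; rewrite -p1 big1 ?eqxx// => j _.
  by apply/eqP; rewrite eq_le p0 andbT -pi0.
by rewrite -p1 (bigD1 i)//= lerDl sumr_ge0.
Qed.

Lemma probability_vector_two {R : realType} {N : nat} (p : 'I_N -> R) (i : 'I_N) :
  probability_vector p -> p i < 1 -> exists2 j, j != i & 0 < p j.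
Proof.
move=> [p0 p1] pi1; apply: contrapT => np.
have := pi1; rewrite -p1 (bigD1 i)//= big1 ?addr0 ?ltxx// => j ji.
apply/eqP; rewrite eq_le p0 andbT leNgt; apply/negP => pj.
by apply: np; exists j.
Qed.

Lemma finite_lower_bound {R : realType} (I : finType) (P : I -> R -> Prop) :
  (forall i d e, d <= e -> P i e -> P i d) ->
  (forall i, exists2 d, 0 < d & P i d) ->
  exists2 d, 0 < d & forall i, P i d.
Proof.
move=> Pmono ex.
have ex' i : exists d, 0 < d /\ P i d by have [d] := ex i; exists d.
have [d dP] := boolp.choice ex'.
exists (\big[Order.min/1]_i d i) => [|i].
  by apply: lt_bigmin => // i _; have [] := dP i.
have [_ Pi] := dP i; apply: Pmono Pi; exact: bigmin_le.
Qed.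

(** * The cascade of a self-similar measure under strong separation *)

Section SelfSimilarCascade.
Context {R : realType} {n N : nat} {c : R} {f : 'I_N -> 'rV[R]_n -> 'rV[R]_n}.
Context {p : 'I_N -> R} {mu : probability 'rV[R]_n R} {K : set 'rV[R]_n}.
Hypotheses (hc : 0 < c < 1) (hf : forall i, similarity c (f i)).
Hypotheses (hp : probability_vector p) (hmu : is_invariant_measure f p mu).
Hypothesis hK : is_attractor f K.
Hypothesis K_disjoint : forall i j, i != j -> (f i @` K) `&` (f j @` K) = set0.

Let c0 : 0 < c. Proof. by case/andP: hc. Qed.
Let c1 : c < 1. Proof. by case/andP: hc. Qed.
Let p0 i : 0 <= p i. Proof. by case: hp. Qed.

Lemma self_similar_gap : exists2 d : R, 0 < d & forall i j u v, i != j ->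
  K u -> K v -> d <= enorm (f i u - f j v).
Proof.
have cfK l : compact (f l @` K).
  apply: continuous_compact; last by case: hK.
  by apply: continuous_subspaceT; exact: (similarity_continuous c0 (hf l)).
pose apart (ij : 'I_N * 'I_N) (d : R) := forall u v, ij.1 != ij.2 -> K u -> K v ->
  d <= enorm (f ij.1 u - f ij.2 v).
have ex ij : exists2 d, 0 < d & apart ij d.
  have [ij12|ij12] := eqVneq ij.1 ij.2.
    by exists 1 => // u v; rewrite ij12 eqxx.
  have [d d0 dP] := compact_disjoint_gap (cfK ij.1) (cfK ij.2) (K_disjoint ij12).
  by exists d => // u v _ Ku Kv; apply: dP; [exists u|exists v].
have mono ij d e : d <= e -> apart ij e -> apart ij d.
  by move=> de H u v ij12 Ku Kv; exact: le_trans de (H u v ij12 Ku Kv).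
have [d d0 dP] := finite_lower_bound mono ex.
by exists d => // i j; exact: (dP (i, j)).
Qed.

Section Orbit.
Variables (w : nat -> 'I_N) (y : nat -> 'rV[R]_n).
Hypotheses (yK : forall k, K (y k)) (yE : forall k, f (w k) (y k.+1) = y k).

(** The sequence [w] is an address of [y 0], and [y k] is what remains of the point after [k] maps
    are undone; [P k] is the weight of its cylinder of level [k]. *)
Let P k := \prod_(j < k) p (w j).

Lemma orbit_mass_ge k r :
  P k * fine (mu (eball (y k) (r / c ^+ k))) <= fine (mu (eball (y 0%N) r)).
Proof.
elim: k => [|k]; first by rewrite /P big_ord0 expr0 mul1r divr1.
apply: le_trans; rewrite /P big_ord_recr /= -mulrA; apply: ler_wpM2l.
  exact: prodr_ge0.
rewrite -[in leRHS]yE exprSr invfM mulrA.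
exact: (mass_eball_image_ge hc hf hp hmu).
Qed.

(** For [j < k] the rescaled radius [r / c ^+ j] is still below [d], so the one-step upper bound
    applies at all of the first [k] levels; the last ball has mass at most 1. *)
Lemma orbit_mass_le (d : R) k r :
  (forall i j u v, i != j -> K u -> K v -> d <= enorm (f i u - f j v)) ->
  0 < d -> r < d * c ^+ k -> fine (mu (eball (y 0%N) r)) <= P k.
Proof.
move=> gap d0 rd.
suff H j : (j <= k)%N -> fine (mu (eball (y 0%N) r)) <=
    P j * fine (mu (eball (y j) (r / c ^+ j))).
  apply: (le_trans (H k (leqnn k))); rewrite ler_piMr ?prodr_ge0//.
  by apply: fine_probability_le1; exact: measurable_eball.
elim: j => [|j IH] jk; first by rewrite /P big_ord0 expr0 mul1r divr1.
apply: (le_trans (IH (ltnW jk))).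
rewrite /P big_ord_recr /= -mulrA; apply: ler_wpM2l; first exact: prodr_ge0.
rewrite -[in leLHS](yE j) exprSr invfM mulrA.
apply: (mass_eball_image_le hc hf hp hmu hK (gap (w j))) => //.
rewrite ltr_pdivrMr ?exprn_gt0//; apply: (lt_le_trans rd).
by rewrite ler_pM2l//; apply: ler_wiXn2l; [exact: ltW|exact: ltW|exact: ltnW].
Qed.

End Orbit.

Lemma attractor_orbit x : K x -> exists w y,
  [/\ y 0%N = x, forall k, K (y k) & forall k, f (w k) (y k.+1) = y k].
Proof.
move=> Kx; have [i0 _] := attractor_preimage hK Kx.
have pre z : exists iy, K z -> K iy.2 /\ f iy.1 iy.2 = z.
  (* Off [K] the pair is a dummy; the iteration starts in [K] and never leaves it. *)
  have [Kz|nKz] := pselect (K z); last by exists (i0, x).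
  by have [i [u Ku uz]] := attractor_preimage hK Kz; exists (i, u).
have [s sP] := boolp.choice pre.
pose y k := iter k (fun z => (s z).2) x.
have yK k : K (y k) by elim: k => //= k /sP[].
by exists (fun k => (s (y k)).1), y; split=> // k; have [] := sP _ (yK k).
Qed.

Lemma self_similar_cascade i0 : 0 < p i0 -> (forall j, p j <= p i0) ->
  exists d D, [/\ 0 < d, 0 < D & cascade c (p i0) d D mu].
Proof.
move=> pi0 pmax; have [_ cK _] := hK.
have [D D0 KD] := compact_enorm_bounded cK.
have [d d0 gap] := self_similar_gap.
have ballD x k r : K x -> D * c ^+ k <= r -> fine (mu (eball x (r / c ^+ k))) = 1.
  move=> Kx Dr; apply: (attractor_full hc hf hp hmu hK).
    exact: measurable_eball.
  by move=> z Kz; rewrite /eball /= ler_pdivlMr ?exprn_gt0// (le_trans _ Dr)//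
    ler_pM2r ?exprn_gt0// KD.
have sK := msupport_sub_attractor hc hf hp hmu hK.
(* The fixed point of [f i] has the constant address [i], so its cylinders weigh [p i ^+ k];
   positivity of these puts it in the support. *)
have fixed i : 0 < p i -> exists x, [/\ msupport mu x, K x, f i x = x &
    forall k, p i ^+ k <= fine (mu (eball x (D * c ^+ k)))].
  move=> pi; have [x Kx fx] := similarity_fixpoint hc hf hK i.
  have massx k r : D * c ^+ k <= r -> p i ^+ k <= fine (mu (eball x r)).
    move=> Dr; have := orbit_mass_ge (w := fun=> i) (y := fun=> x) (fun=> fx) k r.
    by rewrite ballD// mulr1 prodr_const card_ord.
  exists x; split=> // [|k]; last exact: massx.
  apply/msupportP => r r0; have [k kr _] := geometric_scale hc D0 r0.
  by apply: lt_le_trans (massx k r kr); rewrite exprn_gt0.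
exists d, D; split=> //; split.
- by move=> x y /sK Kx /sK; exact: KD.
- move=> x /sK /attractor_orbit[w [y [<- yK yE]]].
  exists (fun k => \prod_(j < k) p (w j)); split=> [|k|k r rd|k r Dr].
  + by rewrite big_ord0.
  + rewrite prodr_ge0//= big_ord_recr/= mulrC; apply: ler_wpM2r => //.
    exact: prodr_ge0.
  + exact: (orbit_mass_le yK yE gap d0 rd).
  + by have := orbit_mass_ge yE k r; rewrite ballD// mulr1.
- by have [x [xs _ _ xm]] := fixed _ pi0; exists x.
(* A second map of positive weight has its own fixed point in the support, at distance at least [d]
   since the two pieces are separated. *)
- move=> pi1; have [j ji pj] := probability_vector_two hp pi1.
  have [x [xs Kx fx _]] := fixed _ pi0; have [z [zs Kz fz _]] := fixed _ pj.
  exists x, z; split=> // xz.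
  have := gap _ _ _ _ ji Kz Kx; rewrite fx fz xz subrr enorm0.
  by rewrite leNgt d0.
Qed.

End SelfSimilarCascade.

(** * Balls, support and cascade of the product measure *)

Section Product.
Context {R : realType} {n1 n2 : nat}.
Implicit Types (z : 'rV[R]_(n1 + n2)) (a : 'rV[R]_n1) (b : 'rV[R]_n2).

Lemma sqr_enorm_submx z :
  enorm z ^+ 2 = enorm (lsubmx z) ^+ 2 + enorm (rsubmx z) ^+ 2.
Proof.
rewrite !sqr_enorm big_split_ord /=.
by congr (_ + _); apply: eq_bigr => i _; rewrite mxE.
Qed.

Lemma enorm_lsubmx_le z : enorm (lsubmx z) <= enorm z.
Proof.
by rewrite -(@ler_pXn2r _ 2) ?nnegrE ?enorm_ge0// sqr_enorm_submx lerDl sqr_ge0.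
Qed.

Lemma enorm_rsubmx_le z : enorm (rsubmx z) <= enorm z.
Proof.
by rewrite -(@ler_pXn2r _ 2) ?nnegrE ?enorm_ge0// sqr_enorm_submx lerDr sqr_ge0.
Qed.

Lemma enorm_le_submx z : enorm z <= enorm (lsubmx z) + enorm (rsubmx z).
Proof.
rewrite -(@ler_pXn2r _ 2) ?nnegrE ?addr_ge0 ?enorm_ge0// sqr_enorm_submx sqrrD.
by rewrite addrAC lerDl mulrn_wge0// mulr_ge0 ?enorm_ge0.
Qed.

Variables (mu : probability 'rV[R]_n1 R) (nu : probability 'rV[R]_n2 R).
Let theta := row_product mu nu.

Lemma row_product_rect A B : measurable A -> measurable B ->
  (mu \x nu)%E (A `*` B) = (fine (mu A) * fine (nu B))%:E.
Proof.
by move=> mA mB; rewrite product_measure1E// EFinM !fine_probabilityK.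
Qed.

Lemma measurable_preimage_row_pair (C : set 'rV[R]_(n1 + n2)) :
  measurable C -> measurable (@row_pair R n1 n2 @^-1` C).
Proof. by move=> mC; rewrite -[_ @^-1` _]setTI; exact: measurable_row_pair. Qed.

Lemma row_product_eball_le z r : fine (theta (eball z r)) <=
  fine (mu (eball (lsubmx z) r)) * fine (nu (eball (rsubmx z) r)).
Proof.
rewrite -lee_fin fine_probabilityK; last exact: measurable_eball.
rewrite -row_product_rect; [|exact: measurable_eball|exact: measurable_eball].
apply: (le_measure (mu \x nu)%E); rewrite ?inE.
- by apply: measurable_preimage_row_pair; exact: measurable_eball.
- by apply: measurableX; exact: measurable_eball.
move=> [a b]; rewrite /eball /row_pair /= => zab; split=> /=.
  apply: le_trans zab; apply: le_trans (enorm_lsubmx_le _).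
  by rewrite linearB /= row_mxKl.
apply: le_trans zab; apply: le_trans (enorm_rsubmx_le _).
by rewrite linearB /= row_mxKr.
Qed.

Lemma row_product_eball_ge z r s :
  fine (mu (eball (lsubmx z) r)) * fine (nu (eball (rsubmx z) s)) <=
  fine (theta (eball z (r + s))).
Proof.
rewrite -lee_fin [leRHS]fine_probabilityK; last exact: measurable_eball.
rewrite -row_product_rect; [|exact: measurable_eball|exact: measurable_eball].
apply: (le_measure (mu \x nu)%E); rewrite ?inE.
- by apply: measurableX; exact: measurable_eball.
- by apply: measurable_preimage_row_pair; exact: measurable_eball.
move=> [a b]; rewrite /eball /row_pair /= => -[/= za zb].
apply: le_trans (enorm_le_submx _) _.
by rewrite !linearB /= row_mxKl row_mxKr lerD.
Qed.

Lemma msupport_row_productP z :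
  msupport theta z <-> msupport mu (lsubmx z) /\ msupport nu (rsubmx z).
Proof.
split=> [/msupportP zs|[/msupportP as_ /msupportP bs]].
  have pos r : 0 < r -> 0 < fine (mu (eball (lsubmx z) r)) /\
      0 < fine (nu (eball (rsubmx z) r)).
    move=> r0; have := lt_le_trans (zs r r0) (row_product_eball_le z r).
    rewrite !lt_neqAle !fine_ge0// !andbT ![0 == _]eq_sym mulf_eq0 negb_or
      mulr_ge0 ?fine_ge0//.
    by rewrite andbT => /andP[].
  by split; apply/msupportP => r /pos[].
apply/msupportP => r r0; have r20 : 0 < r / 2 by rewrite divr_gt0.
rewrite [r]splitr; apply: lt_le_trans (row_product_eball_ge z _ _).
by rewrite mulr_gt0// ?as_// bs.
Qed.

Lemma row_product_cascade (c W1 W2 d1 d2 D1 D2 : R) :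
  0 < c -> 0 < W1 <= 1 -> 0 < W2 <= 1 ->
  cascade c W1 d1 D1 mu -> cascade c W2 d2 D2 nu ->
  cascade c (W1 * W2) (Num.min d1 d2) (D1 + D2) theta.
Proof.
move=> c0 /andP[W10 W11] /andP[W20 W21].
move=> [bd1 m1 [a as_ aW] sp1] [bd2 m2 [b bs bW] sp2].
split.
- move=> z w /msupport_row_productP[z1 z2] /msupport_row_productP[w1 w2].
  apply: (le_trans (enorm_le_submx _)).
  by rewrite !linearB lerD ?bd1 ?bd2.
- move=> z /msupport_row_productP[/m1[P [P0 PW Pub Plb]] /m2[Q [Q0 QW Qub Qlb]]].
  have Pge0 k : 0 <= P k by case: k => [|k]; [rewrite P0|have /andP[] := PW k].
  have Qge0 k : 0 <= Q k by case: k => [|k]; [rewrite Q0|have /andP[] := QW k].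
  exists (fun k => P k * Q k); split=> [|k|k r|k r Dr].
  + by rewrite P0 Q0 mulr1.
  + have [/andP[_ PWk] /andP[_ QWk]] := (PW k, QW k).
    by rewrite mulr_ge0//= mulrACA ler_pM.
  (* The minimum of [d1] and [d2] makes [r] separating in both factors. *)
  + rewrite minr_pMl ?exprn_ge0 ?(ltW c0)// lt_min => /andP[r1 r2].
    apply: (le_trans (row_product_eball_le _ _)).
    by apply: ler_pM; rewrite ?fine_ge0 ?Pub ?Qub.
  (* The radius is split so that the first factor gets exactly its covering radius; what is left is
     at least [D2 * c ^+ k]. *)
  + have := row_product_eball_ge z (D1 * c ^+ k) (r - D1 * c ^+ k).
    rewrite (addrC (D1 * _)) subrK; apply: le_trans; apply: ler_pM => //;
      first exact: Plb.
    by apply: Qlb; rewrite lerBrDl -mulrDl.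
- exists (row_mx a b) => [|k].
    by apply/msupport_row_productP; rewrite row_mxKl row_mxKr.
  rewrite mulrDl; apply: le_trans (row_product_eball_ge _ _ _).
  by rewrite row_mxKl row_mxKr exprMn ler_pM ?exprn_ge0 ?(ltW W10) ?(ltW W20).
move=> W12.
(* A product below 1 has a factor below 1; two support points differing in that factor are completed
   by a common point in the other. *)
have [/sp1[u [v [us vs uv]]]|W1ge] := ltP W1 1.
  exists (row_mx u b), (row_mx v b); split; last by move/eq_row_mx => [].
    by apply/msupport_row_productP; rewrite row_mxKl row_mxKr.
  by apply/msupport_row_productP; rewrite row_mxKl row_mxKr.
have /sp2[u [v [us vs uv]]] : W2 < 1.
  by apply: le_lt_trans W12; rewrite ler_peMl// ltW.
exists (row_mx a u), (row_mx a v); split; last by move/eq_row_mx => [].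
  by apply/msupport_row_productP; rewrite row_mxKl row_mxKr.
by apply/msupport_row_productP; rewrite row_mxKl row_mxKr.
Qed.

End Product.

Unset Implicit Arguments.

Theorem theorem3p21 (R : realType) (m N : nat) (c : R)
    (f g : 'I_N -> 'rV[R]_m -> 'rV[R]_m) (p q : 'I_N -> R)
    (theta1 theta2 : probability 'rV[R]_m R)
    (hc : 0 < c < 1)
    (hf : forall i, similarity c (f i)) (hg : forall i, similarity c (g i))
    (hp : probability_vector p) (hq : probability_vector q)
    (htheta1 : is_invariant_measure f p theta1)
    (htheta2 : is_invariant_measure g q theta2)
    (hSSCf : SSC f) (hSSCg : SSC g) :
  lower_dim (row_product theta1 theta2) =
    (lower_dim theta1 + lower_dim theta2)%E.
Proof.
have [c0 c1] := andP hc.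
have [K hK disjK] := hSSCf; have [L hL disjL] := hSSCg.
(* A point of the attractor lies in some image, which shows that the index set, common to both
   systems, is nonempty. *)
have [[x Kx] _ _] := hK; have [i0 _] := attractor_preimage hK Kx.
have [i pi imax] := probability_vector_max i0 hp.
have [j qj jmax] := probability_vector_max i0 hq.
have [pi0 pi1] := andP pi; have [qj0 qj1] := andP qj.
have [d1 [D1 [d10 D10 C1]]] :=
  self_similar_cascade hc hf hp htheta1 hK disjK pi0 imax.
have [d2 [D2 [d20 D20 C2]]] :=
  self_similar_cascade hc hg hq htheta2 hL disjL qj0 jmax.
rewrite (lower_dim_cascade hc pi d10 D10 C1) (lower_dim_cascade hc qj d20 D20 C2).
have pq : 0 < p i * q j <= 1 by rewrite mulr_gt0//= mulr_ile1// ltW.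
have d0 : 0 < Num.min d1 d2 by rewrite lt_min d10.
rewrite (lower_dim_cascade hc pq d0 (addr_gt0 D10 D20)
  (row_product_cascade c0 pi qj C1 C2)).
by rewrite lnM ?posrE// mulrDl EFinD.
Qed.
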